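(* For $k\ge1$ let $F_{11\text{-}2}(x;k)=\sum_{n\ge0}|[k]^n(11\text{-}2)|x^n$, where $[k]^n(11\text{-}2)$ is the set of words $\sigma=\sigma_1\cdots\sigma_n$ over $\{1,\dots,k\}$ for which there are no indices $i,j$ with $j>i+1$ and $\sigma_i=\sigma_{i+1}<\sigma_j$. Then for all $k\ge1$, \[ F_{11\text{-}2}(x;k)=\prod_{j=0}^{k-1}\frac{1-(j-1)x}{1-(j+x)x}. \]
   Context: The empty word (length $0$) is counted once. *)

(* Defs.v *)
From HB Require Import structures.
From mathcomp Require Import all_boot all_algebra.
From mathcomp Require Import boolp.

Set Implicit Arguments.
Unset Strict Implicit.
Unset Printing Implicit Defensive.

Import GRing.Theory.
Local Open Scope ring_scope.

(* Formal power series R[[x]]. A record rather than a notation for nat -> R, on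
   which other libraries put the pointwise product. *)
Record fps (R : Type) := Fps { fps_coef :> nat -> R }.

Lemma fpsP (R : Type) (f g : fps R) : (forall n, f n = g n) <-> f = g.
Proof. by case: f g => [f] [g]; split=> [/= /funext -> | ->]. Qed.

HB.instance Definition _ (R : Type) := gen_eqMixin (fps R).
HB.instance Definition _ (R : Type) := gen_choiceMixin (fps R).

Section FpsZmodule.
Variable R : zmodType.
Implicit Types f g h : fps R.

Definition fps_zero : fps R := Fps (fun=> 0).
Definition fps_opp f : fps R := Fps (fun n => - f n).
Definition fps_add f g : fps R := Fps (fun n => f n + g n).

Fact fps_addA : associative fps_add.
Proof. by move=> f g h; apply/fpsP=> n /=; rewrite addrA. Qed.
Fact fps_addC : commutative fps_add.
Proof. by move=> f g; apply/fpsP=> n /=; rewrite addrC. Qed.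
Fact fps_add0 : left_id fps_zero fps_add.
Proof. by move=> f; apply/fpsP=> n /=; rewrite add0r. Qed.
Fact fps_addN : left_inverse fps_zero fps_opp fps_add.
Proof. by move=> f; apply/fpsP=> n /=; rewrite addNr. Qed.

HB.instance Definition _ :=
  GRing.isZmodule.Build (fps R) fps_addA fps_addC fps_add0 fps_addN.

End FpsZmodule.

Section FpsRing.
Variable R : comNzRingType.
Implicit Types f g h : fps R.

Definition fps_one : fps R := Fps (fun n => (n == 0%N)%:R).
Definition fpsX : fps R := Fps (fun n => (n == 1%N)%:R).
Definition fps_mul f g : fps R := Fps (fun n => \sum_(i < n.+1) f i * g (n - i)%N).

Definition fps_trunc N f : {poly R} := \poly_(i < N) f i.

Fact fps_mulE N f g n : (n < N)%N ->
  fps_mul f g n = (fps_trunc N f * fps_trunc N g)`_n.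
Proof.
move=> ltnN; rewrite coefM /=; apply: eq_bigr => i _; rewrite !coef_poly.
by rewrite (leq_ltn_trans (leq_subr i n) ltnN) (leq_ltn_trans (leq_ord i) ltnN).
Qed.

Fact fps_mulC : commutative fps_mul.
Proof. by move=> f g; apply/fpsP=> n; rewrite !(@fps_mulE n.+1) // mulrC. Qed.

Fact fps_mulA : associative fps_mul.
Proof.
move=> f g h; apply/fpsP=> n.
transitivity (fps_trunc n.+1 f * (fps_trunc n.+1 g * fps_trunc n.+1 h))`_n.
  rewrite coefM /=; apply: eq_bigr => i _.
  by rewrite coef_poly ltn_ord -fps_mulE // ltnS leq_subr.
rewrite mulrA coefM /=; apply: eq_bigr => i _.
by rewrite coef_poly ltnS leq_subr -fps_mulE.
Qed.

Fact fps_mul1 : left_id fps_one fps_mul.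
Proof.
move=> f; apply/fpsP=> n /=; rewrite big_ord_recl /= mul1r subn0.
by rewrite big1 ?addr0 // => i _; rewrite mul0r.
Qed.

Fact fps_mulDl : left_distributive fps_mul (@fps_add R).
Proof.
move=> f g h; apply/fpsP=> n /=; rewrite -big_split /=.
by apply: eq_bigr => i _; rewrite mulrDl.
Qed.

Fact fps_one_neq0 : fps_one != 0.
Proof. by apply/eqP=> /fpsP/(_ 0%N)/eqP /=; rewrite oner_eq0. Qed.

HB.instance Definition _ := GRing.Zmodule_isComNzRing.Build (fps R)
  fps_mulA fps_mulC fps_mul1 fps_mulDl fps_one_neq0.

End FpsRing.

Notation "''fpsX'" := (@fpsX _) (at level 0) : ring_scope.

Section FpsUnitRing.
Variable R : comUnitRingType.
Implicit Types f g : fps R.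

Definition fps_unit : {pred fps R} := [pred f : fps R | f 0%N \is a GRing.unit].

(* The first n.+1 coefficients of the inverse g of f, obtained by solving
   \sum_(i <= n) f (n - i) * g i = (n == 0) for g n. *)
Fixpoint fps_inv_seq f n : seq R :=
  if n is m.+1 then
    let s := fps_inv_seq f m in
    rcons s (- ((f 0%N)^-1 * \sum_(i < n) f (n - i)%N * s`_i))
  else [:: (f 0%N)^-1].

(* As usual for GRing.inv, a series that is not a unit is its own inverse. *)
Definition fps_inv f : fps R :=
  if f \in fps_unit then Fps (fun n => (fps_inv_seq f n)`_n) else f.

Fact size_fps_inv_seq f n : size (fps_inv_seq f n) = n.+1.
Proof. by elim: n => //= n IHn; rewrite size_rcons IHn. Qed.

Fact nth_fps_inv_seq f m n : (m <= n)%N ->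
  (fps_inv_seq f n)`_m = (fps_inv_seq f m)`_m.
Proof.
elim: n => [|n IHn]; first by rewrite leqn0 => /eqP ->.
rewrite leq_eqVlt => /orP[/eqP -> // | ltmn].
by rewrite /= nth_rcons size_fps_inv_seq ltmn IHn.
Qed.

Fact fps_mulVf : {in fps_unit, left_inverse 1 fps_inv *%R}.
Proof.
move=> f Uf; rewrite /fps_inv Uf; apply/fpsP=> n.
rewrite /GRing.mul /GRing.one /=; case: n => [|n].
  by rewrite big_ord1 /= mulVr.
rewrite big_ord_recr /= subnn nth_rcons size_fps_inv_seq ltnn eqxx.
rewrite mulNr mulrAC mulVr // mul1r; apply/eqP; rewrite subr_eq0; apply/eqP.
apply: eq_bigr => i _; rewrite mulrC; congr (_ * _).
by rewrite [RHS]nth_fps_inv_seq ?leq_ord.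
Qed.

Fact fps_unitP f g : g * f = 1 -> fps_unit f.
Proof.
move=> /fpsP/(_ 0%N); rewrite /GRing.mul /GRing.one /= big_ord1 /= => gf1.
by apply/unitrP; exists (g 0%N); rewrite (mulrC (f _)) gf1.
Qed.

Fact fps_inv_out : {in [predC fps_unit], fps_inv =1 id}.
Proof. by move=> f /negPf nUf; rewrite /fps_inv nUf. Qed.

HB.instance Definition _ := GRing.ComNzRing_hasMulInverse.Build (fps R)
  fps_mulVf fps_unitP fps_inv_out.

Lemma fps_unitE f : (f \is a GRing.unit) = (f 0%N \is a GRing.unit).
Proof. by []. Qed.

End FpsUnitRing.

(* Words of length n over {1, ..., k}, where the letter a is represented by the
   ordinal a - 1 : 'I_k, and positions are numbered from 0. The index i1 is
   i + 1, so that i1 < j is the gap condition j > i + 1. *)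
Definition avoids_11_2 (k n : nat) (s : n.-tuple 'I_k) : bool :=
  ~~ [exists i : 'I_n, exists i1 : 'I_n, exists j : 'I_n,
        [&& i1 == i.+1 :> nat, (i1 < j)%N,
            tnth s i == tnth s i1 & (tnth s i1 < tnth s j)%N]].

Definition words_11_2 (k n : nat) : {set n.-tuple 'I_k} :=
  [set s | avoids_11_2 s].

Definition F_11_2 (k : nat) : fps rat := Fps (fun n => #|words_11_2 k n|%:R).

(* The denominators below have constant coefficient 1, hence are units. *)
Fact denominator_unit (j : nat) :
  (1 - (j%:R + 'fpsX) * 'fpsX : fps rat) \is a GRing.unit.
Proof.
by rewrite fps_unitE /GRing.mul /= big_ord1 /= mulr0 subr0 unitr1.
Qed.

(* Main.v *)
(** Reading a word from left to right, once [a a] has been read every later letter is at most [a];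
    and if all letters of [s] are at most [a], then [a a s] avoids 11-2 iff [s] does. Let [F_m] be
    the generating function for [m] letters and [B_(m,a)] that of the words [t] such that [a t]
    avoids. Splitting [t] according to whether it starts with [a] gives
    [(1 + x) B_(m,a) = F_m + x F_a], while [F_m = 1 + x (B_(m,1) + ... + B_(m,m))]. Eliminating
    [B] gives [(1 + x - m x) F_m = 1 + x + x^2 (F_1 + ... + F_m)], and the difference of two
    consecutive such equations is [(1 - m x - x^2) F_(m+1) = (1 - (m - 1) x) F_m]. *)
Require Import Defs.
From mathcomp Require Import all_boot all_algebra.
From mathcomp Require Import zify ring.

Import GRing.Theory.
Local Open Scope ring_scope.

(** Lists of naturals let alphabets of different sizes share one predicate. Prepending [a] creates a
    new pattern only if the next letter is [a] too. *)
Fixpoint avoids (s : seq nat) : bool :=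
  if s is a :: t then avoids t && ((ohead t == Some a) ==> all (geq a) t)
  else true.

Lemma avoids_cons2_eq a s : avoids [:: a, a & s] = all (geq a) s && avoids s.
Proof. by rewrite /= eqxx leqnn /=; case: (all _ s); rewrite ?implybT ?andbF ?andbT. Qed.

Lemma avoids_cons2_neq a b s :
  b != a -> avoids [:: a, b & s] = avoids (b :: s).
Proof. by move=> /negPf neq_ba /=; rewrite (inj_eq Some_inj) neq_ba andbT. Qed.

Lemma avoidsP s :
  reflect (forall i j, (i.+1 < j < size s)%N -> nth 0%N s i = nth 0%N s i.+1 ->
             (nth 0%N s j <= nth 0%N s i.+1)%N)
          (avoids s).
Proof.
elim: s => [|a s IHs] /=; first by constructor=> i j; rewrite ltn0 andbF.
apply: (iffP andP) => [[/IHs avs /implyP as_le] i [//|j] | avs].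
- rewrite ltnS => /andP[ltij ltjs].
  case: i => [|i] /= in ltij *; last by move=> eqi; apply: avs; rewrite // ltij.
  case: s ltjs as_le {IHs avs} => [//|b s] ltjs as_le /= eq_ab; subst b.
  have /allP := as_le (eqxx _); apply.
  by rewrite -[j]/(0 + j)%N mem_nth.
- split; first by apply/IHs => i j ltijs; apply: (avs i.+1 j.+1).
  apply/implyP; case: s avs {IHs} => [//|b s] avs /eqP[eq_ba]; subst b.
  (* Entry [0] of the tail is the second copy of [b], too close for the gap condition. *)
  apply/(all_nthP 0%N) => -[_|j ltjs] /=; first exact: leqnn.
  exact: (avs 0%N j.+2).
Qed.

Arguments avoids : simpl never.

Lemma avoids_11_2E k n (s : n.-tuple 'I_k) :
  avoids_11_2 s = avoids (map val s).
Proof.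
have nthE (i : 'I_n) : nth 0%N (map val s) i = tnth s i.
  (* The default [ord0] needs a nonempty alphabet; for [k = 0] a position would yield a letter in
     ['I_0]. *)
  case: k s => [|k] s; first by case: (tnth s i).
  by rewrite (nth_map ord0) ?size_tuple // -tnth_nth.
apply/idP/avoidsP => [avs i j | avs].
  rewrite size_map size_tuple => /andP[ltij ltjn] eqi.
  have lti1n := ltn_trans ltij ltjn; have ltin := ltnW lti1n.
  rewrite leqNgt; apply: contra avs => ltj.
  apply/existsP; exists (Ordinal ltin); apply/existsP; exists (Ordinal lti1n).
  apply/existsP; exists (Ordinal ltjn); rewrite eqxx ltij /= -!nthE ltj andbT.
  by apply/eqP/val_inj; rewrite /= -!nthE.
apply/negP => /existsP[i /existsP[i1 /existsP[j]]].
case/and4P=> /eqP eqi1 lti1j /eqP eqs; apply/negP; rewrite -leqNgt -!nthE eqi1.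
by apply: avs; rewrite ?size_map ?size_tuple -eqi1 ?lti1j ?nthE ?eqs /=.
Qed.

(** [P] varies so that it can absorb the letters already read. *)
Fixpoint num_words (P : pred (seq nat)) (m n : nat) : nat :=
  if n is n'.+1 then \sum_(a < m) num_words (fun s => P (val a :: s)) m n'
  else P [::].

Lemma eq_num_words P Q m n : P =1 Q -> num_words P m n = num_words Q m n.
Proof.
elim: n P Q => [|n IHn] P Q eqPQ /=; first by rewrite eqPQ.
by apply: eq_bigr => a _; apply: IHn => s; apply: eqPQ.
Qed.

Lemma num_words_pred0 m n : num_words pred0 m n = 0%N.
Proof. by elim: n => //= n IHn; rewrite big1. Qed.

(** Letters start at [0], so those at most [a] form an alphabet of size [a.+1]; a first letter above
    [a] makes the predicate constantly false. *)
Lemma num_words_all_leq P m n a : (a < m)%N ->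
  num_words (fun s => all (geq a) s && P s) m n = num_words P a.+1 n.
Proof.
move=> ltam; elim: n P => //= n IHn P.
rewrite [RHS](big_ord_widen m (fun b => num_words (fun s => P (b :: s)) a.+1 n)) //.
rewrite [RHS]big_mkcond /=; apply: eq_bigr => b _; rewrite ltnS.
by case: leqP => _ /=; rewrite ?IHn ?num_words_pred0.
Qed.

Lemma sum_tuple_num_words (P : pred (seq nat)) m n :
  (\sum_(s : n.-tuple 'I_m) P (map val s))%N = num_words P m n.
Proof.
elim: n P => [|n IHn] P /=.
  by rewrite (big_pred1 [tuple]) // => s; apply/esym/eqP/tuple0.
rewrite (reindex (fun p : 'I_m * n.-tuple 'I_m => cons_tuple p.1 p.2)) /=; last first.
  exists (fun s : n.+1.-tuple 'I_m => (thead s, behead_tuple s)) => [[a s] _ | s _].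
    by congr (_, _); rewrite ?theadE //; apply: val_inj.
  by rewrite [RHS]tuple_eta; apply: val_inj.
rewrite -(pair_bigA _ (fun a (s : n.-tuple 'I_m) => P (val a :: map val s) : nat)) /=.
by apply: eq_bigr => a _; rewrite -IHn.
Qed.

Lemma card_words_11_2 k n : #|words_11_2 k n| = num_words avoids k n.
Proof.
rewrite -sum_tuple_num_words -sum1_card big_mkcond.
by apply: eq_bigr => s _; rewrite inE avoids_11_2E; case: avoids.
Qed.

(** This is the coefficient of [x^(n+1)] in [(1 + x) B_(m,a) = F_m + x F_a], with letters shifted to
    start at [0]. *)
Lemma num_words_avoids_cons m n a : (a < m)%N ->
  (num_words (fun s => avoids (a :: s)) m n.+1
     + num_words (fun s => avoids (a :: s)) m n
   = num_words avoids m n.+1 + num_words avoids a.+1 n)%N.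
Proof.
move=> ltam /=; rewrite !(bigD1 (Ordinal ltam) (P := predT)) //=.
rewrite (eq_num_words _ _ m n (avoids_cons2_eq a)) num_words_all_leq //.
rewrite [X in (_ + X + _)%N](eq_bigr
  (fun b : 'I_m => num_words (fun s => avoids (val b :: s)) m n)).
  by rewrite addnC [X in (_ + X)%N]addnC addnA.
move=> b neq_ba; apply: eq_num_words => s.
exact: avoids_cons2_neq.
Qed.

Lemma num_words_avoids_sum m n :
  (num_words avoids m n.+2 + num_words avoids m n.+1
   = m * num_words avoids m n.+1 + \sum_(a < m) num_words avoids a.+1 n)%N.
Proof.
pose B n' := (\sum_(a < m) num_words (fun s => avoids (val a :: s)) m n')%N.
(* Splitting off the first letter, [B n'] is by definition [num_words avoids m n'.+1]. *)
transitivity (B n.+1 + B n)%N => //.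
have -> : (m * num_words avoids m n.+1 = \sum_(a < m) num_words avoids m n.+1)%N.
  by rewrite sum_nat_const card_ord.
rewrite -!big_split; apply: eq_bigr => a _.
exact: (num_words_avoids_cons m n a (ltn_ord a)).
Qed.

(** Subtracting the sums for [m] and [m.+1] leaves only the last summand; the terms are arranged to
    avoid subtraction in [nat]. *)
Lemma num_words_avoids_rec m n :
  (num_words avoids m.+1 n.+2 + m * num_words avoids m n.+1
   = m * num_words avoids m.+1 n.+1 + num_words avoids m n.+2
     + num_words avoids m n.+1 + num_words avoids m.+1 n)%N.
Proof.
have sumSm : (\sum_(a < m.+1) num_words avoids a.+1 n
    = \sum_(a < m) num_words avoids a.+1 n + num_words avoids m.+1 n)%N.
  by rewrite big_ord_recr.
have := num_words_avoids_sum m.+1 n; rewrite sumSm mulSn.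
by have := num_words_avoids_sum m n; lia.
Qed.

Lemma num_words_avoids1 m : num_words avoids m 1 = m.
Proof. by rewrite /= sum1_card card_ord. Qed.

Lemma fps_coefMX (R : comNzRingType) (f : fps R) n :
  (f * 'fpsX) n = if n is n'.+1 then f n' else 0.
Proof.
rewrite [f * _]mulrC /GRing.mul /= big_ord_recl mul0r add0r.
case: n => [|n]; first by rewrite big_ord0.
rewrite big_ord_recl /= mul1r subSS subn0 big1 ?addr0 // => i _.
by rewrite mul0r.
Qed.

Lemma fps_coef_natmul (R : comNzRingType) (f : fps R) m n :
  (m%:R * f) n = m%:R * f n.
Proof.
elim: m => [|m IHm]; first by rewrite !mul0r.
by rewrite -add1n !natrD !mulrDl !mul1r -IHm.
Qed.

Lemma F_11_2_rec m :
  F_11_2 m.+1 * (1 - (m%:R + 'fpsX) * 'fpsX) = F_11_2 m * (1 - (m%:R - 1) * 'fpsX).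
Proof.
suff: F_11_2 m.+1 + m%:R * (F_11_2 m * 'fpsX)
    = m%:R * (F_11_2 m.+1 * 'fpsX) + F_11_2 m + F_11_2 m * 'fpsX
      + F_11_2 m.+1 * 'fpsX * 'fpsX.
  move=> eqF; apply/eqP; rewrite -subr_eq0; apply/eqP.
  by move/eqP: eqF; rewrite -subr_eq0 => /eqP <-; ring.
have coefF i j : F_11_2 i j = (num_words avoids i j)%:R :> rat.
  by rewrite /= card_words_11_2.
have coefD (f g : fps rat) n : (f + g) n = f n + g n by [].
apply/fpsP => n; rewrite !(coefD, fps_coef_natmul, fps_coefMX) !coefF.
(* The recurrence starts at coefficient [2]; the first two are computed directly. *)
case: n => [|[|n]].
- by rewrite /=; ring.
- by rewrite !fps_coefMX !coefF !num_words_avoids1 /= -natr1; ring.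
rewrite !fps_coefMX !coefF -!natrM -!natrD.
by congr _%:R; apply: num_words_avoids_rec.
Qed.

Lemma F_11_2_0 : F_11_2 0 = 1.
Proof.
apply/fpsP => -[|n] /=; rewrite card_words_11_2 //=.
by rewrite big_ord0.
Qed.

Theorem theorem3p2 (k : nat) (hk : (1 <= k)%N) :
  F_11_2 k =
  \prod_(0 <= j < k) ((1 - (j%:R - 1) * 'fpsX) / (1 - (j%:R + 'fpsX) * 'fpsX)).
Proof.
elim: k {hk} => [|k IHk]; first by rewrite big_geq // F_11_2_0.
(* The new numerator times [F_11_2 k] is [F_11_2 k.+1] times the new denominator, a unit that
   cancels. *)
rewrite big_nat_recr //= -IHk mulrA -F_11_2_rec mulrK //.
exact: denominator_unit.
Qed.
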